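(* As power series in $x$, $$\mathcal{F}(x)=x^2\mathcal{F}(x^4)-\frac{2x^6}{1+x^8}+\frac{1}{1+x^4}+\frac{x}{1+x^2}$$ and $$\mathcal{G}(x)=x^4\mathcal{G}(x^4)-\frac{1-x^8}{1+x^8}+\frac{x^2}{1+x^4}-\frac{x}{1+x^2}.$$
   Context: A word is a finite sequence; $[\cdot,\cdot]$ denotes concatenation, $-\boldsymbol{w}$ is the word with all entries negated, $\overleftarrow{\boldsymbol{w}}$ is the reversed word. Let $\boldsymbol{w}_0=\boldsymbol{w}_1$ be the empty word and, for $n\ge2$, $\boldsymbol{w}_n=[\boldsymbol{w}_{n-2},\,(-1)^n,\,-\overleftarrow{\boldsymbol{w}_{n-2}},\,(-1)^n,\,\boldsymbol{w}_{n-1}]$, a word with entries $\pm1$. For a finite sequence $a=(a_0,\dots,a_N)$ let $\operatorname{GF}(a)=\sum_{m=0}^Na_mx^m$ (and $0$ for the empty word). Since $\boldsymbol{w}_{n-2}$ is a prefix of $\boldsymbol{w}_n$, the coefficientwise limits $\mathcal{F}(x)=\lim_{n\to\infty}\operatorname{GF}(\boldsymbol{w}_{2n})$ and $\mathcal{G}(x)=\lim_{n\to\infty}\operatorname{GF}(\boldsymbol{w}_{2n+1})$ exist as power series in $x$. *)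

(* Defs.v *)
From HB Require Import structures.
From mathcomp Require Import all_boot all_order all_algebra.
From mathcomp Require Import boolp classical_sets.
Set Implicit Arguments.
Unset Strict Implicit.
Unset Printing Implicit Defensive.
Import Order.TTheory GRing.Theory Num.Theory.
Local Open Scope ring_scope.

(* Formal power series; [f n] is the coefficient of x^n. *)
Record fps (R : Type) := Fps { fps_coef :> nat -> R }.

Lemma fpsP (R : Type) (f g : fps R) : (forall n, f n = g n) <-> f = g.
Proof.
split=> [|-> //]; case: f g => [f] [g] /= fg; congr Fps.
by apply: functional_extensionality_dep => n; apply: fg.
Qed.

HB.instance Definition _ (R : Type) := gen_eqMixin (fps R).
HB.instance Definition _ (R : Type) := gen_choiceMixin (fps R).

Section FpsRing.
Variable R : comNzRingType.
Implicit Types f g h : fps R.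

Definition fps_zero : fps R := Fps (fun=> 0).
Definition fps_opp f : fps R := Fps (fun n => - f n).
Definition fps_add f g : fps R := Fps (fun n => f n + g n).
Definition fpsC (c : R) : fps R := Fps (fun n => if n == 0%N then c else 0).
Definition fps_mul f g : fps R :=
  Fps (fun n => \sum_(i < n.+1) f i * g (n - i)%N).

Lemma fps_addA : associative fps_add.
Proof. by move=> f g h; apply/fpsP => n /=; rewrite addrA. Qed.
Lemma fps_addC : commutative fps_add.
Proof. by move=> f g; apply/fpsP => n /=; rewrite addrC. Qed.
Lemma fps_add0 : left_id fps_zero fps_add.
Proof. by move=> f; apply/fpsP => n /=; rewrite add0r. Qed.
Lemma fps_addN : left_inverse fps_zero fps_opp fps_add.
Proof. by move=> f; apply/fpsP => n /=; rewrite addNr. Qed.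

HB.instance Definition _ := GRing.isZmodule.Build (fps R)
  fps_addA fps_addC fps_add0 fps_addN.

Definition fps_trunc N f : {poly R} := \poly_(i < N) f i.

Lemma fps_mul_trunc N f g n : (n < N)%N ->
  fps_mul f g n = (fps_trunc N f * fps_trunc N g)`_n.
Proof.
move=> ltnN; rewrite coefM /=; apply: eq_bigr => i _.
by rewrite !coef_poly !(leq_ltn_trans _ ltnN) ?leq_subr // -ltnS.
Qed.

Lemma fps_mulC : commutative fps_mul.
Proof.
by move=> f g; apply/fpsP => n; rewrite !(@fps_mul_trunc n.+1) // mulrC.
Qed.

Lemma fps_mulA : associative fps_mul.
Proof.
move=> f g h; apply/fpsP => n.
transitivity ((fps_trunc n.+1 f * fps_trunc n.+1 g * fps_trunc n.+1 h)`_n).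
  rewrite -mulrA coefM; apply: eq_bigr => i _.
  rewrite coef_poly ltn_ord; congr (_ * _).
  by apply: fps_mul_trunc; rewrite ltnS leq_subr.
rewrite coefM; apply: eq_bigr => i _.
rewrite [X in _ * X]coef_poly ltnS leq_subr; congr (_ * _).
by rewrite [RHS](@fps_mul_trunc n.+1).
Qed.

Lemma fps_mul1 : left_id (fpsC 1) fps_mul.
Proof.
move=> f; apply/fpsP => n /=.
by rewrite big_ord_recl /= mul1r subn0 big1 ?addr0 // => i _; rewrite mul0r.
Qed.

Lemma fps_mulDl : left_distributive fps_mul fps_add.
Proof.
move=> f g h; apply/fpsP => n /=; rewrite -big_split /=.
by apply: eq_bigr => i _; rewrite mulrDl.
Qed.

Lemma fps_1neq0 : fpsC 1 != 0.
Proof.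
apply/eqP => /fpsP/(_ 0%N) /= /eqP.
by rewrite (oner_eq0 R).
Qed.

HB.instance Definition _ := GRing.Zmodule_isComNzRing.Build (fps R)
  fps_mulA fps_mulC fps_mul1 fps_mulDl fps_1neq0.

Definition fpsX : fps R := Fps (fun n => (n == 1%N)%:R).

(* Substitution f(g(x)). Each coefficient is the finite sum
   [x^n] sum_(i <= n) f_i g^i, the right value when g has no constant term. *)
Definition fps_comp f g : fps R :=
  Fps (fun n => \sum_(i < n.+1) f i * (g ^+ i) n).

Lemma fps_coef0 n : (0 : fps R) n = 0. Proof. by []. Qed.
Lemma fps_coef1 n : (1 : fps R) n = (n == 0%N)%:R.
Proof. by rewrite /=; case: eqP. Qed.
Lemma fps_coefD f g n : (f + g) n = f n + g n. Proof. by []. Qed.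
Lemma fps_coefN f n : (- f) n = - f n. Proof. by []. Qed.
Lemma fps_coefB f g n : (f - g) n = f n - g n. Proof. by []. Qed.
Lemma fps_coefM f g n : (f * g) n = \sum_(i < n.+1) f i * g (n - i)%N.
Proof. by []. Qed.
Lemma fps_coef_sum I (r : seq I) (P : pred I) (F : I -> fps R) n :
  (\sum_(i <- r | P i) F i) n = \sum_(i <- r | P i) F i n.
Proof. by apply: (big_morph (fun f : fps R => f n)). Qed.

Lemma fps_coefMXn f k n :
  (f * fpsX ^+ k) n = if (n < k)%N then 0 else f (n - k)%N.
Proof.
elim: k n => [|k IHk] n; first by rewrite expr0 mulr1 subn0.
rewrite exprSr mulrA mulrC fps_coefM; case: n => [|n].
  by rewrite big_ord1 mul0r.
rewrite big_ord_recl mul0r add0r big_ord_recl big1 => [|i _].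
  have -> : (n.+1 - lift ord0 (ord0 : 'I_n.+1) = n)%N.
    by rewrite /= /bump /= subSS subn0.
  by rewrite addr0 [fpsX _]/= mul1r IHk ltnS subSS.
by rewrite [fpsX _]/= mul0r.
Qed.

Lemma fps_coefXn k n : (fpsX ^+ k) n = (n == k)%:R.
Proof.
rewrite -[_ ^+ _]mul1r fps_coefMXn fps_coef1 subn_eq0.
by case: (ltngtP n k).
Qed.

Lemma fps_coef_exp_small f i n : f 0%N = 0 -> (n < i)%N -> (f ^+ i) n = 0.
Proof.
move=> f0; elim: i n => // i IHi n ltni.
rewrite exprS fps_coefM big_ord_recl f0 mul0r add0r big1 // => j _.
rewrite IHi ?mulr0 //= /bump add1n; case: n j ltni => [[]//|n] j ltni.
by rewrite subSS (leq_ltn_trans (leq_subr _ _)).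
Qed.

Lemma fps_coef_compXn f k n : (0 < k)%N ->
  fps_comp f (fpsX ^+ k) n = if (k %| n)%N then f (n %/ k)%N else 0.
Proof.
move=> k0 /=; have lt : (n %/ k < n.+1)%N by rewrite ltnS leq_div.
case: ifP => [kn | knN].
  rewrite (bigD1 (Ordinal lt)) //= -exprM fps_coefXn mulnC divnK // eqxx mulr1.
  rewrite big1 ?addr0 // => i; rewrite -val_eqE /= => ne.
  rewrite -exprM fps_coefXn; case: eqP => [E|]; last by rewrite mulr0.
  by case/eqP: ne; rewrite [X in (X %/ _)%N]E mulKn.
rewrite big1 // => i _; rewrite -exprM fps_coefXn.
by case: eqP => [E|]; [rewrite E dvdn_mulr in knN | rewrite mulr0].
Qed.

End FpsRing.

Section FpsInverse.
Variable R : comUnitRingType.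
Implicit Types f g : fps R.

Definition fps_unit : pred (fps R) := fun f => f 0%N \is a GRing.unit.

(* With c = f_0 and u = 1 - f/c, f^-1 = c^-1 (1 + u + u^2 + ...). *)
Definition fps_inv f : fps R :=
  if fps_unit f
  then fpsC (f 0%N)^-1 * fps_comp (Fps (fun=> 1)) (1 - fpsC (f 0%N)^-1 * f)
  else f.

Lemma fps_geometric (u : fps R) : u 0%N = 0 ->
  (1 - u) * fps_comp (Fps (fun=> 1)) u = 1.
Proof.
move=> u0; apply/fpsP => n.
transitivity (((1 - u) * \sum_(i < n.+1) u ^+ i) n).
  rewrite !fps_coefM; apply: eq_bigr => j _; congr (_ * _).
  rewrite fps_coef_sum /= -!(big_mkord xpredT (fun i => (u ^+ i) (n - j)%N)).
  under eq_bigr do rewrite mul1r.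
  rewrite -(big_mkord xpredT (fun i => (u ^+ i) (n - j)%N)).
  have le : ((n - j).+1 <= n.+1)%N by rewrite ltnS leq_subr.
  rewrite [RHS](big_cat_nat (leq0n _) le) /=.
  rewrite [X in _ = _ + X]big_nat_cond.
  rewrite [X in _ = _ + X]big1 ?addr0 // => i /andP[/andP[lti _] _].
  exact: fps_coef_exp_small.
by rewrite -opprB mulNr -subrX1 opprB fps_coefB fps_coef_exp_small // subr0.
Qed.

Lemma fps_mulVr : {in fps_unit, left_inverse 1 fps_inv *%R}.
Proof.
move=> f uf; have uf0 : f 0%N \is a GRing.unit := uf.
rewrite /fps_inv /fps_unit uf0.
set u := 1 - _; have u0 : u 0%N = 0.
  by rewrite fps_coefB fps_coefM big_ord1 /= mulVr // subrr.
by rewrite mulrAC -[_ * f](subKr 1) -/u fps_geometric.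
Qed.

Lemma fps_unitP f g : g * f = 1 -> fps_unit f.
Proof.
move=> /fpsP/(_ 0%N); rewrite fps_coefM big_ord1 fps_coef1 /= => gf.
by apply/unitrP; exists (g 0%N); rewrite [f _ * _]mulrC gf.
Qed.

Lemma fps_inv_out : {in [predC fps_unit], fps_inv =1 id}.
Proof. by move=> f uf; apply: ifN. Qed.

HB.instance Definition _ := GRing.ComNzRing_hasMulInverse.Build (fps R)
  fps_mulVr fps_unitP fps_inv_out.

Lemma fps_unitE f : (f \is a GRing.unit) = (f 0%N \is a GRing.unit).
Proof. by []. Qed.

End FpsInverse.

Arguments fpsX {R}.

(* Coefficientwise convergence: each coefficient is eventually constant. *)
Definition fps_cvg (R : Type) (u : nat -> fps R) (f : fps R) : Prop :=
  forall m, exists N, forall n, (N <= n)%N -> u n m = f m.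

(* The zero series is a junk value, returned when there is no limit. *)
Definition fps_lim (R : nzRingType) (u : nat -> fps R) : fps R :=
  xget (Fps (fun=> 0)) [set f | fps_cvg u f]%classic.

Lemma fps_cvg_unique (R : Type) (u : nat -> fps R) f g :
  fps_cvg u f -> fps_cvg u g -> f = g.
Proof.
move=> uf ug; apply/fpsP => m; have [N uN] := uf m; have [M uM] := ug m.
by rewrite -(uN (maxn N M)) ?leq_maxl // uM ?leq_maxr.
Qed.

Lemma fps_cvg_lim (R : nzRingType) (u : nat -> fps R) f :
  fps_cvg u f -> fps_lim u = f.
Proof.
move=> uf; apply: (fps_cvg_unique _ uf).
by rewrite /fps_lim; apply: (@xgetI _ _ _ f).
Qed.

Fixpoint word (n : nat) : seq int :=
  match n with
  | 0 | 1 => [::]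
  | (k.+1 as m).+1 =>
      word k ++ [:: (-1) ^+ n] ++ [seq - e | e <- rev (word k)] ++ [:: (-1) ^+ n]
        ++ word m
  end.

Lemma wordSS n : word n.+2 = word n ++ [:: (-1) ^+ n.+2] ++ [seq - e | e <- rev (word n)]
  ++ [:: (-1) ^+ n.+2] ++ word n.+1.
Proof. by []. Qed.

Definition GF (a : seq int) : fps int :=
  \sum_(m < size a) fpsC a`_m * fpsX ^+ m.

Definition calF : fps int := fps_lim (fun n => GF (word n.*2)).
Definition calG : fps int := fps_lim (fun n => GF (word n.*2.+1)).

Lemma coef_GF a m : GF a m = a`_m.
Proof.
rewrite fps_coef_sum; under eq_bigr do rewrite fps_coefMXn.
have [lt|le] := ltnP m (size a).
  rewrite (bigD1 (Ordinal lt)) //= ltnn subnn big1 ?addr0 // => i.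
  rewrite -val_eqE /= => ne; case: ltnP => // le.
  by rewrite subn_eq0 leqNgt ltn_neqAle ne le.
rewrite nth_default // big1 // => i _.
have lt := leq_trans (ltn_ord i) le.
by rewrite ltnNge (ltnW lt) /= subn_eq0 leqNgt lt.
Qed.

Lemma prefix_cvg (v : nat -> seq int) :
    (forall n, prefix (v n) (v n.+1)) ->
    (forall n, (size (v n) < size (v n.+1))%N) ->
  fps_cvg (fun n => GF (v n)) (fps_lim (fun n => GF (v n))).
Proof.
move=> vp vs; have sz n : (n <= size (v n))%N.
  by elim: n => // n IHn; apply: leq_ltn_trans IHn (vs n).
have cv : fps_cvg (fun n => GF (v n)) (Fps (fun m => (v m.+1)`_m)).
  move=> m; exists m.+1 => n /subnK <-; rewrite coef_GF /=.
  elim: (n - _)%N => // d <-; rewrite addSn.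
  have /prefixP [s ->] := vp (d + m.+1)%N; rewrite nth_cat.
  by rewrite (leq_trans _ (sz _)) // addnS ltnS leq_addl.
by rewrite (fps_cvg_lim cv).
Qed.

Lemma word_prefix n : prefix (word n) (word n.+2).
Proof. by rewrite wordSS prefix_prefix. Qed.

Lemma word_size n : (size (word n) < size (word n.+2))%N.
Proof. by rewrite wordSS size_cat /= addnS ltnS leq_addr. Qed.

Lemma calF_cvg : fps_cvg (fun n => GF (word n.*2)) calF.
Proof.
by apply: prefix_cvg => n; rewrite doubleS; [apply: word_prefix|apply: word_size].
Qed.

Lemma calG_cvg : fps_cvg (fun n => GF (word n.*2.+1)) calG.
Proof.
by apply: prefix_cvg => n; rewrite doubleS; [apply: word_prefix|apply: word_size].
Qed.

(* Main.v *)
Require Import Defs.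
From mathcomp Require Import all_boot all_order all_algebra.
From mathcomp Require Import zify ring.
Set Implicit Arguments.
Unset Strict Implicit.
Unset Printing Implicit Defensive.
Import GRing.Theory.
Local Open Scope ring_scope.

(** Both series are the two sides of one sequence indexed by the integers, a
    paperfolding sequence centred at the 2-adic point 1/3. For an
    integer p write 3p - 1 = (-2)^v u with u odd; up to the sign (-1)^p, the
    value a(p) = [paperfold p] is the nontrivial character mod 4 at u. The map
    q |-> 1 - 2q fixes 1/3 and multiplies 3q - 1 by -2, so that

      a(2q) = -(-1)^q    and    a(1 - 2q) = -(-1)^q a(q),

    and everything below follows from these two rules.

    The words are windows of a ending next to the origin: with s = (-1)^n, the
    entry of w_n at index m is s a(s (m + 1)) ([nth_word]). To see this, put
    c_n = s (|w_n| + 1). The lengths satisfy c_0 = 1 and c_(n+1) = 1 - 2 c_n,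
    so c_n approximates 1/3 to order 2^(n+1), and a inherits an antisymmetry
    about c_n:

      a(c_n + t) = - a(c_n - t)    unless 2^(n+1) divides t

    ([paperfold_reflect]). The distance |w_n| + |w_(n+1)| + 2 = 2^(n+1) is
    exactly the room that the recursion for w_(n+2) needs: for t up to
    |w_n| the antisymmetry produces the block - rev w_n; for t beyond |w_n| + 1
    it lands on the other side of the origin, where the words of the other
    parity live, and produces the final block w_(n+1).

    Hence F_m = a(m + 1) and G_m = - a(-m - 1), and applying the second rule
    twice gives a(4q - 1) = -(-1)^q a(q) and a(4q + 1) = (-1)^q. So on three of
    the residue classes mod 4 the coefficients are explicit signs, which give
    the rational terms, and on the fourth they repeat the whole series up to
    a sign alternating with q. Where that sign is wrong, the repeated
    coefficient is a value of a at an even argument, hence known, and the term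
    with denominator 1 + x^8 corrects it; for G that term also supplies the
    constant coefficient -1. *)

(** * The bi-infinite paperfolding sequence *)

Definition chi4 (z : int) : int := if (z %% 4)%Z == 1 then 1 else -1.

(** Powers of -2 rather than of 2 are divided out, so that the result is
    invariant under the factor -2 by which q |-> 1 - 2q scales 3q - 1. *)
Definition odd_part (z : int) : int := (z %/ (-2) ^+ logn 2 `|z|)%Z.

Definition paperfold (p : int) : int :=
  (-1) ^+ odd `|p| * chi4 (odd_part (3 * p - 1)).

Lemma odd_part_odd (z : int) : odd `|z| -> odd_part z = z.
Proof.
by move=> zo; rewrite /odd_part lognE dvdn2 zo andbF expr0 divz1.
Qed.

Lemma odd_partMN2 (z : int) : z != 0 -> odd_part (-2 * z) = odd_part z.
Proof.
move=> z0; rewrite /odd_part abszM lognM ?absz_gt0 // add1n.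
have /dvdzP [k zk] : ((-2 : int) ^+ logn 2 `|z| %| z)%Z.
  by rewrite dvdzE abszX pfactor_dvdnn.
have nz v : (-2 : int) ^+ v != 0 by rewrite expf_neq0.
by rewrite {1 3}zk mulrCA -exprS !mulzK.
Qed.

(** Here 3 * (2 q) - 1 is odd, and mod 4 it is 1 or -1 according to the parity
    of q. *)
Lemma paperfold_even (q : int) : paperfold (2 * q) = - (-1) ^+ `|q|.
Proof.
rewrite /paperfold odd_part_odd ?/chi4 -?(signr_odd _ `|q|); last lia.
have -> : odd `|(2 * q)%R| = false by lia.
rewrite expr0 mul1r; case: (boolP (odd `|q|)) => qo.
  by rewrite ifT ?expr1 //; lia.
by rewrite ifF ?expr0 //; lia.
Qed.

(** Since 3 (1 - 2 q) - 1 = -2 (3 q - 1), the character takes the same value at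
    both points; only the sign (-1)^p can differ. *)
Lemma paperfold_odd (q : int) :
  paperfold (1 - 2 * q) = - (-1) ^+ `|q| * paperfold q.
Proof.
rewrite /paperfold.
have -> : 3 * (1 - 2 * q) - 1 = -2 * (3 * q - 1) by ring.
rewrite odd_partMN2; last lia.
have -> : odd `|(1 - 2 * q)%R| by lia.
by rewrite mulrA mulNr -{2}[`|q|%N]addn0 -(signr_odd _ `|q|) addn0; case: odd.
Qed.

Lemma paperfold_4B1 (q : int) :
  paperfold (4 * q - 1) = - (-1) ^+ `|q| * paperfold q.
Proof.
have -> : 4 * q - 1 = 1 - 2 * (1 - 2 * q) by ring.
rewrite !paperfold_odd -(signr_odd _ (absz (1 - 2 * q)%R)).
have -> : odd (absz (1 - 2 * q)%R) by lia.
by rewrite opprK mul1r.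
Qed.

Lemma paperfold_4D1 (q : int) : paperfold (4 * q + 1) = (-1) ^+ `|q|.
Proof.
have -> : 4 * q + 1 = 1 - 2 * (2 * - q) by ring.
rewrite paperfold_odd paperfold_even -(signr_odd _ (absz (2 * - q)%R)) abszN.
have -> : odd (absz (2 * - q)%R) = false by lia.
by rewrite mulN1r opprK.
Qed.

(** * Antisymmetry about the centers *)

Definition center (n : nat) : int := (-1) ^+ n * (size (word n)).+1%:Z.

Lemma size_wordSS n :
  size (word n.+2) = ((size (word n)).*2 + size (word n.+1) + 2)%N.
Proof. by rewrite wordSS !size_cat size_map size_rev /=; lia. Qed.

Lemma centerS n : center n.+1 = 1 - 2 * center n.
Proof.
rewrite /center; elim: n => [//|n IHn].
rewrite size_wordSS; move: IHn; rewrite !exprS.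
by rewrite -(signr_odd _ n); case: (odd n); rewrite ?expr0 ?expr1; lia.
Qed.

Lemma size_word_add n :
  ((size (word n)).+1 + (size (word n.+1)).+1 = 2 ^ n.+1)%N.
Proof. by elim: n => [//|n IHn]; rewrite size_wordSS expnS; lia. Qed.

Lemma center_odd n : odd `|center n|.
Proof. by case: n => [//|n]; rewrite centerS; lia. Qed.

Lemma paperfold_center n : paperfold (center n) = 1.
Proof.
elim: n => [|n IHn]; first exact: (paperfold_odd 0).
by rewrite centerS paperfold_odd IHn -signr_odd center_odd.
Qed.

(** For odd t both arguments are even, and their halves add up to the odd
    number c_n, so the explicit values have opposite signs. For even t the
    substitution q |-> 1 - 2q carries the antisymmetry about c_n, with range
    2^(n+1), to the one about c_(n+1), with twice that range. *)
Lemma paperfold_reflect n (t : int) : ~~ (2 ^ n.+1 %| `|t|)%N ->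
  paperfold (center n + t) = - paperfold (center n - t).
Proof.
have generic m (s : int) : odd `|s| ->
    paperfold (center m + s) = - paperfold (center m - s).
  move=> so; have co := center_odd m.
  have [q Eq] : exists q, center m + s = 2 * q.
    by exists ((center m + s) %/ 2)%Z; lia.
  have -> : center m - s = 2 * (center m - q) by lia.
  rewrite Eq !paperfold_even -(signr_odd _ `|q|) -(signr_odd _ `|_ - q|).
  have -> : odd `|(center m - q)%R| = ~~ odd `|q| by lia.
  by case: odd.
elim: n t => [|n IHn] t tn.
  by apply: generic; move: tn; rewrite dvdn2; lia.
case: (boolP (odd `|t|)) => [/generic //|te].
have [s Es] : exists s, t = - 2 * s by exists (- (t %/ 2)%Z); lia.
have sn : ~~ (2 ^ n.+1 %| `|s|)%N.
  by move: tn; rewrite Es abszM expnS dvdn_pmul2l.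
rewrite Es centerS.
have -> : 1 - 2 * center n + -2 * s = 1 - 2 * (center n + s) by ring.
have -> : 1 - 2 * center n - -2 * s = 1 - 2 * (center n - s) by ring.
rewrite !paperfold_odd IHn // mulrN.
rewrite -(signr_odd _ `|_ + s|) -(signr_odd _ `|_ - s|).
by have -> : odd `|(center n + s)%R| = odd `|(center n - s)%R| by lia.
Qed.

(** * The words as windows of the sequence *)

(** The positive side of the sequence for even n, the negated mirror image of
    the negative side for odd n, both read outwards from the origin. *)
Definition side (n p : nat) : int := (-1) ^+ n * paperfold ((-1) ^+ n * p%:Z).

Lemma sideSS n : side n.+2 =1 side n.
Proof. by move=> p; rewrite /side !exprS !mulN1r opprK. Qed.

Lemma side_center n : side n (size (word n)).+1 = (-1) ^+ n.
Proof. by rewrite /side -/(center n) paperfold_center mulr1. Qed.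

Lemma side_double n : side n (2 * (size (word n)).+1)%N = (-1) ^+ n.
Proof.
rewrite /side.
have -> : (-1) ^+ n * (2 * (size (word n)).+1)%N%:Z = 2 * center n.
  by rewrite PoszM mulrCA.
rewrite paperfold_even.
by rewrite -(signr_odd _ (absz (center n))) center_odd opprK mulr1.
Qed.

Lemma side_reflect n i : (0 < i < 2 ^ n.+1)%N ->
  side n ((size (word n)).+1 + i)%N =
  - ((-1) ^+ n * paperfold (center n - (-1) ^+ n * i%:Z)).
Proof.
move=> /andP[i0 lti]; rewrite /side PoszD mulrDr -/(center n).
rewrite (@paperfold_reflect n (_ * _)) ?mulrN // abszMsign.
by apply: contraL lti => /dvdn_leq; rewrite -leqNgt; apply.
Qed.

(** While the reflected point stays on the same side of the origin, the
    antisymmetry reverses and negates the word. *)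
Lemma side_mirror n i : (i < size (word n))%N ->
  side n ((size (word n)).+1 + i.+1)%N = - side n (size (word n) - i)%N.
Proof.
move=> lti; rewrite side_reflect; last by have := size_word_add n; lia.
rewrite /side /center -mulrBr -subzn; last lia.
by congr (- (_ * paperfold (_ * _))); lia.
Qed.

(** Past twice the center, the reflected point has crossed the origin, and the
    side of the other parity is read in increasing order. *)
Lemma side_shift n i : (i < size (word n.+1))%N ->
  side n (2 * (size (word n)).+1 + i.+1)%N = side n.+1 i.+1.
Proof.
move=> lti; have -> : (2 * (size (word n)).+1 + i.+1 =
  (size (word n)).+1 + ((size (word n)).+1 + i.+1))%N by lia.
rewrite side_reflect; last by have := size_word_add n; lia.
rewrite PoszD mulrDr -/(center n) opprD addNKr.
by rewrite /side exprS !mulN1r !mulNr.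
Qed.

(* Keeps the last block, [word n.+1], folded when a concatenation is reduced. *)
#[local] Arguments word : simpl never.

Lemma nth_word n m : (m < size (word n))%N -> (word n)`_m = side n m.+1.
Proof.
elim/ltn_ind: n m => -[|[|n]] // IHn m.
rewrite sideSS size_wordSS wordSS exprS exprS !mulN1r opprK => ltm.
rewrite nth_cat; case: ltnP => [/IHn-> //|le1].
have [d Em] : exists d, m = (size (word n) + d)%N.
  by exists (m - size (word n))%N; rewrite subnKC.
rewrite {}Em addKn -addSn in ltm *.
case: d ltm => [|i] ltm; first by rewrite addn0 side_center.
rewrite /= nth_cat size_map size_rev; case: ltnP => [lti|le2].
  rewrite side_mirror // (nth_map 0) ?size_rev // nth_rev // IHn ?subnSK //.
  by rewrite leq_subr.
have [d Ei] : exists d, i = (size (word n) + d)%N.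
  by exists (i - size (word n))%N; rewrite subnKC.
rewrite {}Ei addKn in ltm *; case: d ltm => [|k] ltm /=.
  by rewrite addn0 addnn -mul2n side_double.
have -> : ((size (word n)).+1 + (size (word n) + k.+1).+1 =
  2 * (size (word n)).+1 + k.+1)%N by lia.
by rewrite side_shift ?IHn //; lia.
Qed.

Lemma leq_size_word n :
  (n <= size (word n.*2))%N /\ (n <= size (word n.*2.+1))%N.
Proof.
elim: n => // n [IH1 IH2]; rewrite doubleS; split.
  exact: leq_ltn_trans IH1 (word_size _).
exact: leq_ltn_trans IH2 (word_size _).
Qed.

Lemma signr_double n : (-1) ^+ n.*2 = 1 :> int.
Proof. by rewrite -signr_odd odd_double. Qed.

Lemma coef_calF m : calF m = paperfold m.+1%:Z.
Proof.
have [N cvN] := calF_cvg m; rewrite -(cvN (maxn N m.+1)) ?leq_maxl // coef_GF.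
rewrite nth_word; first by rewrite /side signr_double !mul1r.
exact: leq_trans (leq_maxr N _) (leq_size_word _).1.
Qed.

Lemma coef_calG m : calG m = - paperfold (- m.+1%:Z).
Proof.
have [N cvN] := calG_cvg m; rewrite -(cvN (maxn N m.+1)) ?leq_maxl // coef_GF.
rewrite nth_word; first by rewrite /side exprS signr_double mulr1 !mulN1r.
exact: leq_trans (leq_maxr N _) (leq_size_word _).2.
Qed.

(** * Coefficients along residue classes *)

Lemma coef_Xn_comp (R : comNzRingType) (f : fps R) k r q s :
  (r < k)%N -> (s < k)%N ->
  (fpsX ^+ r * fps_comp f (fpsX ^+ k)) (k * q + s)%N =
  if s == r then f q else 0.
Proof.
move=> ltr lts; have k0 : (0 < k)%N by apply: leq_trans ltr.
rewrite mulrC fps_coefMXn fps_coef_compXn //.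
case: ltnP => [lt|le].
  rewrite ifF //; apply/eqP => E; move: lt; rewrite E.
  by rewrite ltnNge leq_addl.
case: (ltngtP s r) => [sr|rs|->].
- rewrite ifF //; apply/negP => /dvdnP [d Ed].
  have : (k * q + s = k * d + r)%N by lia.
  move/(congr1 (modn^~ k)).
  by rewrite ![(k * _)%N]mulnC !modnMDl !modn_small //; lia.
- rewrite -addnBA ?(ltnW rs) // dvdn_addr ?dvdn_mulr // gtnNdvd ?subn_gt0 //.
  exact: leq_ltn_trans (leq_subr _ _) lts.
by rewrite addnK dvdn_mulr // mulKn.
Qed.

Lemma inv_1DXn (R : comUnitRingType) k : (0 < k)%N ->
  (1 + fpsX ^+ k)^-1 =
  fps_comp (Fps (fun i => (-1) ^+ i)) (fpsX ^+ k) :> fps R.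
Proof.
move=> k0; have u : (1 + fpsX ^+ k : fps R) \is a GRing.unit.
  by rewrite fps_unitE fps_coefD fps_coef1 fps_coefXn (ltn_eqF k0) addr0 unitr1.
apply: (mulrI u); rewrite mulrV // mulrDl mul1r [_ ^+ k * _]mulrC.
apply/fpsP => n; rewrite fps_coefD fps_coefMXn !fps_coef_compXn // fps_coef1.
have [lt|le] := ltnP n k.
  rewrite addr0; have [->|n0] := posnP n; first by rewrite dvdn0 div0n.
  by rewrite gtnNdvd // gtn_eqF.
rewrite dvdn_subl // gtn_eqF ?(leq_trans k0) //.
case: ifP => [kn|_]; last by rewrite addr0.
by rewrite -{1}(subnK le) divnDr // divnn k0 addn1 /= exprS mulN1r addNr.
Qed.

Lemma coef_Xn_geom (R : comUnitRingType) k r q s : (r < k)%N -> (s < k)%N ->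
  (fpsX ^+ r / (1 + fpsX ^+ k) : fps R) (k * q + s)%N =
  if s == r then (-1) ^+ q else 0.
Proof.
by move=> ltr lts; rewrite inv_1DXn ?(leq_trans _ ltr) // coef_Xn_comp.
Qed.

(** * The functional equations *)

Lemma calF_eq :
  calF = fpsX ^+ 2 * fps_comp calF (fpsX ^+ 4)
         - 2 * fpsX ^+ 6 / (1 + fpsX ^+ 8)
         + 1 / (1 + fpsX ^+ 4) + fpsX / (1 + fpsX ^+ 2).
Proof.
have -> : 1 / (1 + fpsX ^+ 4) = fpsX ^+ 0 / (1 + fpsX ^+ 4) :> fps int by [].
rewrite -[fpsX / _]/(fpsX ^+ 1 / _) -[2 * _ / _]mulrA mulr_natl mulr2n.
apply/fpsP => n; rewrite !fps_coefD fps_coefN fps_coefD.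
(* k = 2 j + b, since the terms over 1 + x^8 depend on the parity of k. *)
have [j [b [s [lts En]]]] : exists j (b : bool) s,
    (s < 4)%N /\ n = (4 * (2 * j + b) + s)%N.
  exists (n %/ 8)%N, (4 <= n %% 8)%N, (n %% 4)%N; lia.
set k := (2 * j + b)%N in En *.
have E8 : n = (8 * j + (4 * b + s))%N by lia.
have E2 : n = (2 * (2 * k + s./2) + odd s)%N by lia.
rewrite [in X in X + _ + _ + _]En coef_Xn_comp //.
rewrite [in X in _ - X + _ + _]E8 coef_Xn_geom //; last lia.
rewrite [in X in _ + X + _]En coef_Xn_geom //.
rewrite [in X in _ + X]E2 coef_Xn_geom //; last by case: odd.
rewrite !coef_calF.
have odd_coef i : paperfold (2 * i).+2%:Z = (-1) ^+ i.
  have -> : (2 * i).+2%:Z = 2 * i.+1%:Z by lia.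
  by rewrite paperfold_even exprS mulN1r opprK.
have even8 : (4 * b + s == 6)%N = b && (s == 2%N) by case: (b); lia.
rewrite even8; case: s lts En E8 E2 {even8} => [|[|[|[|//]]]] _ En E8 E2 /=.
- rewrite andbF subr0 addr0 add0r.
  have -> : n.+1%:Z = 4 * k%:Z + 1 by lia.
  by rewrite paperfold_4D1.
- have -> : n.+1 = (2 * (2 * k + 0)).+2 by lia.
  by rewrite odd_coef andbF subr0 !add0r.
- have -> : n.+1%:Z = 4 * k.+1%:Z - 1 by lia.
  rewrite paperfold_4B1 exprS mulN1r opprK !addr0 andbT /k.
  case: (b) => /=; last by rewrite addn0 mulnC exprM sqrr_sign mul1r subr0.
  (* The sign of the self-similar part is wrong, and k + 1 is even. *)
  rewrite addn1 odd_coef exprS mulnC exprM sqrr_sign mulr1 mulN1r.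
  by rewrite opprD addNKr.
- have -> : n.+1 = (2 * (2 * k + 1)).+2 by lia.
  by rewrite odd_coef andbF subr0 !add0r.
Qed.

Lemma calG_eq :
  calG = fpsX ^+ 4 * fps_comp calG (fpsX ^+ 4)
         - (1 - fpsX ^+ 8) / (1 + fpsX ^+ 8)
         + fpsX ^+ 2 / (1 + fpsX ^+ 4) - fpsX / (1 + fpsX ^+ 2).
Proof.
(* From 1 - x^8 = 2 - (1 + x^8): the rational terms now have the form
   x^r / (1 + x^k), apart from a constant. *)
have -> : (1 - fpsX ^+ 8) / (1 + fpsX ^+ 8) =
    fpsX ^+ 0 / (1 + fpsX ^+ 8) + fpsX ^+ 0 / (1 + fpsX ^+ 8) - 1 :> fps int.
  have u : (1 + fpsX ^+ 8 : fps int) \is a GRing.unit.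
    by rewrite fps_unitE fps_coefD fps_coef1 fps_coefXn addr0 unitr1.
  rewrite -mulrDl -[X in _ = _ - X](mulrV u) -mulrBl.
  by congr (_ / _); rewrite expr0 opprD addrACA subrr add0r.
rewrite -[fpsX / _]/(fpsX ^+ 1 / _).
apply/fpsP => n.
(* k = 2 j + b, since the terms over 1 + x^8 depend on the parity of k. *)
have [j [b [s [lts En]]]] : exists j (b : bool) s,
    (s < 4)%N /\ n = (4 * (2 * j + b) + s)%N.
  exists (n %/ 8)%N, (4 <= n %% 8)%N, (n %% 4)%N; lia.
set k := (2 * j + b)%N in En *.
have E8 : n = (8 * j + (4 * b + s))%N by lia.
have E2 : n = (2 * (2 * k + s./2) + odd s)%N by lia.
have shift : (fpsX ^+ 4 * fps_comp calG (fpsX ^+ 4)) n =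
    if (s == 0%N) && (0 < k)%N then calG k.-1 else 0.
  rewrite mulrC fps_coefMXn En; case: (k) => [|i]; first by rewrite lts andbF.
  rewrite ltnNge mulnS -addnA leq_addr addKn andbT.
  by rewrite -[fps_comp _ _]mul1r -(expr0 fpsX) coef_Xn_comp.
have n0 : (n == 0)%N = (s == 0%N) && (k == 0)%N by lia.
rewrite !fps_coefD !fps_coefN !fps_coefD fps_coefN fps_coef1 n0 shift.
rewrite [in X in _ - X + _ - _]E8 coef_Xn_geom //; last lia.
rewrite [in X in _ + X - _]En coef_Xn_geom //.
rewrite [in X in _ - X]E2 coef_Xn_geom //; last by case: odd.
rewrite !coef_calG.
have odd_coef i : paperfold (- (2 * i).+2%:Z) = (-1) ^+ i.
  have -> : - (2 * i).+2%:Z = 2 * - i.+1%:Z by lia.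
  by rewrite paperfold_even abszN exprS mulN1r opprK.
have even8 : (4 * b + s == 0)%N = ~~ b && (s == 0%N) by case: (b); lia.
rewrite even8; case: s lts En {E8 E2 shift even8 n0} => [|[|[|[|//]]]] _ En /=.
- have -> : - n.+1%:Z = 4 * - k%:Z - 1 by lia.
  rewrite paperfold_4B1 abszN mulNr opprK andbT !subr0 ?addr0.
  have [k0|k_gt0] := posnP k.
    have [-> ->] : j = 0%N /\ b = false.
      by move: k0; rewrite /k; case: (b) => /=; lia.
    by rewrite k0 oppr0 expr0 mul1r (paperfold_even 0).
  rewrite prednK // subr0 /k.
  case: (b) => /=.
    by rewrite addn1 exprS mulnC exprM sqrr_sign mulr1 mulN1r subr0.
  (* The sign of the self-similar part is wrong, and k is even. *)
  have -> : - (2 * j + 0)%N%:Z = 2 * - j%:Z by lia.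
  rewrite paperfold_even abszN addn0 mulnC exprM sqrr_sign mul1r opprK.
  by rewrite opprD addNKr.
- have -> : n.+1 = (2 * (2 * k + 0)).+2 by lia.
  by rewrite odd_coef andbF !subr0 !add0r.
- have -> : - n.+1%:Z = 4 * - k.+1%:Z + 1 by lia.
  rewrite paperfold_4D1 abszN exprS mulN1r opprK andbF.
  by rewrite !subr0 !add0r.
- have -> : n.+1 = (2 * (2 * k + 1)).+2 by lia.
  by rewrite odd_coef andbF !subr0 !add0r.
Qed.

Theorem theorem2p2p8 :
  (calF = fpsX ^+ 2 * fps_comp calF (fpsX ^+ 4)
          - 2 * fpsX ^+ 6 / (1 + fpsX ^+ 8)
          + 1 / (1 + fpsX ^+ 4) + fpsX / (1 + fpsX ^+ 2))
  /\
  (calG = fpsX ^+ 4 * fps_comp calG (fpsX ^+ 4)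
          - (1 - fpsX ^+ 8) / (1 + fpsX ^+ 8)
          + fpsX ^+ 2 / (1 + fpsX ^+ 4) - fpsX / (1 + fpsX ^+ 2)).
Proof. by split; [exact: calF_eq | exact: calG_eq]. Qed.
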